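(* Let $0<p<1$, let $n=n_1\le n_2$, $m$ and $k\le n$ be positive integers, and let $\mathcal{A}:\mathbb{R}^{n_1\times n_2}\to\mathbb{R}^m$ be a linear operator. For $X_0\in\mathbb{R}^{n_1\times n_2}$ consider the problem $$\text{minimize } \sum_{i=1}^{n}\sigma_i(X)^p\quad\text{subject to } X\in\mathbb{R}^{n_1\times n_2},\ \mathcal{A}(X)=\mathcal{A}(X_0).\qquad(\ast)$$ (Sufficiency) If $$\sum_{i=1}^{2k}\sigma_i(W)^p\le\sum_{i=2k+1}^{n}\sigma_i(W)^p\quad\text{for all } W \text{ in the null space of } \mathcal{A},$$ then for every $X_0$ with $\operatorname{rank}(X_0)=k$, the global minimizer of $(\ast)$ is $X_0$ (that is, $X_0$ is the unique global minimizer). (Necessity) If for every $X_0$ with $\operatorname{rank}(X_0)=k$ the global minimizer of $(\ast)$ is $X_0$ (that is, $X_0$ is the unique global minimizer), then $$\sum_{i=1}^{k}\sigma_i(W)^p\le\sum_{i=k+1}^{n}\sigma_i(W)^p\quad\text{for all } W \text{ in the null space of } \mathcal{A}.$$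
   Context: $\sigma_i(X)$ is the $i$th largest singular value of $X$, with the convention $\sigma_i(X)=0$ for $i>n$; empty sums are $0$. The quantity $\sum_{i=1}^n\sigma_i(X)^p$ is the ($p$th power of the) Schatten-$p$ quasi-norm. *)

(* Defs.v *)
From mathcomp Require Import all_boot all_order all_algebra.
From mathcomp Require Import polyrcf.
From mathcomp Require Import all_classical all_reals all_analysis.

Set Implicit Arguments.
Unset Strict Implicit.
Unset Printing Implicit Defensive.

Import Order.TTheory GRing.Theory Num.Theory.
Local Open Scope classical_set_scope.
Local Open Scope ring_scope.

(* Real eigenvalues repeated with algebraic multiplicity, which for a symmetric
   matrix is also the geometric one. *)
Definition eigenvalues (R : rcfType) (n : nat) (A : 'M[R]_n) : seq R :=
  flatten [seq nseq (mup x (char_poly A)) x | x <- rootsR (char_poly A)].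

(* Sorted in nonincreasing order. The list has n1 entries, so it ends with extra
   zeros when n2 < n1. *)
Definition singular_values (R : rcfType) (n1 n2 : nat) (X : 'M[R]_(n1, n2)) :
    seq R :=
  sort >=%R [seq Num.sqrt x | x <- eigenvalues (X *m X^T)].

(* The index i starts at 1; only 1 <= i is meaningful. Beyond the end of the
   list the value is 0. *)
Definition sigma (R : rcfType) (n1 n2 : nat) (i : nat) (X : 'M[R]_(n1, n2)) :
    R :=
  (singular_values X)`_i.-1.

(* The p-th power of the Schatten-p quasi-norm. *)
Definition schatten (R : realType) (n1 n2 : nat) (p : R)
    (X : 'M[R]_(n1, n2)) : R :=
  \sum_(1 <= i < n1.+1) sigma i X `^ p.

Definition global_minimizers (R : realType) (T : Type) (f : T -> R)
    (S : set T) : set T :=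
  [set x | S x /\ forall y, S y -> f x <= f y].

(* Main.v *)
Require Import Defs.
From mathcomp Require Import all_boot all_order all_algebra.
From mathcomp Require Import fingroup perm polyrcf.
From mathcomp Require spectral.
From mathcomp Require Import (canonicals) complex.
From mathcomp Require Import all_classical all_reals all_analysis.
From mathcomp Require Import ring lra zify.

(** Write |X| for the Schatten functional, the sum of the sigma_i(X)^p. Both
    halves rest on one truncated triangle inequality: if C = A + B has rank at
    most k, then |C| is at most the sum of the k largest terms of |A| plus the
    sum of the k largest terms of |B| ([schatten_rankD]).

    Sufficiency. Let rank X0 = k, let W be a nonzero element of the null space
    and X = X0 + W. As X0 = X - W, the truncated inequality bounds the k largest
    terms of |X| below by |X0| minus the k largest terms of |W|. As W is X
    perturbed by a matrix of rank k, sigma_{i+k}(W) <= sigma_i(X)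
    ([sigma_add_rank]), so the remaining terms of |X| dominate the terms of |W|
    of index beyond 2k. By hypothesis these are at least the 2k largest terms of
    |W|, so |X| - |X0| is at least the sum of the terms of |W| of index k+1 to
    2k. This is positive: otherwise sigma_{k+1}(W) = 0, the terms beyond 2k
    vanish, and the hypothesis forces W = 0.

    Necessity. Write W = U^T S V. Let X0 be minus the part of W carried by the k
    largest singular values, each vanishing one among them being replaced by 1,
    so that X0 has rank exactly k. Then |X0| - |X0 + W| is exactly the k largest
    terms of |W| minus the others ([exists_rank_schattenB]), because the
    replaced values contribute equally to X0 and to X0 + W. Minimality of X0
    makes this difference nonpositive.

    The truncated inequality is the full one, |A + B| <= |A| + |B|
    ([schattenD]), applied to AQ and BQ with Q the orthogonal projection onto a
    k-dimensional space containing the row space of C: CQ = C, and the projection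
    increases no singular value and leaves at most k nonzero ones.

    The full inequality holds for any nondecreasing concave function f vanishing
    at 0 in place of x^p. Such an f is, on a finite set of points, a combination with
    nonnegative coefficients of the functions min(x, t), so these suffice
    ([concave_sum_ge0]). For them, the sum of the min(sigma_i(X), t) is the
    minimum of (nuclear norm of X1) + t (rank of X2) over all decompositions
    X = X1 + X2 ([truncate_svd], [min_sigma_le]), and both the nuclear norm
    ([nuclearD]) and the rank are subadditive.

    All this uses a singular value decomposition, which is derived from the
    real spectral theorem ([sym_spectral]), and a comparison principle of
    Courant-Fischer type ([sigma_le_on_kernel]). *)

Set Implicit Arguments.
Unset Strict Implicit.
Unset Printing Implicit Defensive.
Import Order.TTheory GRing.Theory Num.Theory.
Local Open Scope ring_scope.

(** * Real symmetric matrices *)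

Section Spectral.
Variable R : rcfType.

(** The eigenvalue comes from the complex spectral theorem: over the
    complex numbers the matrix is Hermitian, so its eigenvalues are real, and an
    eigenvalue lying in the base field has an eigenvector there. *)
Lemma sym_eigenvalue n (A : 'M[R]_n.+1) :
  A^T = A -> exists a, eigenvalue A a.
Proof.
move=> symA; pose C : numClosedFieldType := complex.complex R.
pose toC : {rmorphism R -> C} := complex.real_complex R.
pose AC : 'M[C]_n.+1 := map_mx toC A.
have hermAC : AC \is hermsymmx.
  apply: spectral.realsym_hermsym.
    apply/is_hermitianmxP.
    rewrite expr0 scale1r; apply/matrixP => i j; rewrite !mxE.
    by have /matrixP/(_ i j) := symA; rewrite mxE => ->.
  apply/mxOverP => i j; rewrite mxE.
  by rewrite complex.complex_real.
have := spectral.hermitian_spectral_diag_real hermAC.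
have := hermAC; move=> /spectral.hermitian_normalmx /spectral.orthomx_spectralP.
set P := spectral.spectralmx AC; set D := spectral.spectral_diag AC => eqA.
have uP : P \in unitmx by exact: spectral.spectral_unit.
move=> /mxOverP /(_ 0 0) realD.
exists (complex.Re (D 0 0)); rewrite -(eigenvalue_map toC) -/AC.
rewrite [toC _](complex.RRe_real realD).
apply/eigenvalueP; exists (row 0 P); last first.
  apply/eqP => rowP0; have := mulmxV uP.
  move=> /(congr1 (row 0)); rewrite row_mul rowP0 mul0mx.
  by move=> /rowP /(_ 0); rewrite !mxE eqxx => /esym/eqP; rewrite oner_eq0.
rewrite eqA !mulmxA -row_mul mulmxV // row1 -rowE row_diag_mx -scalemxAl.
by rewrite -rowE.
Qed.

Lemma row_diag_mul m n (d : 'rV[R]_m) (A : 'M[R]_(m, n)) i :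
  row i (diag_mx d *m A) = d 0 i *: row i A.
Proof. by apply/rowP => j; rewrite mul_diag_mx !mxE. Qed.

Lemma mulmx_trE m n (Y : 'M[R]_(m, n)) i j :
  (Y *m Y^T) i j = \sum_l Y i l * Y j l.
Proof. by rewrite mxE; apply: eq_bigr => l _; rewrite mxE. Qed.

Lemma mulmx_tr_ge0 n (v : 'rV[R]_n) : 0 <= (v *m v^T) 0 0.
Proof. by rewrite mulmx_trE sumr_ge0 // => l _; rewrite -expr2 sqr_ge0. Qed.

Lemma mulmx_tr_eq0 n (v : 'rV[R]_n) : ((v *m v^T) 0 0 == 0) = (v == 0).
Proof.
apply/eqP/eqP => [|->]; last by rewrite mul0mx mxE.
rewrite mulmx_trE => /eqP; rewrite psumr_eq0 => [/allP v0|l _]; last first.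
  by rewrite -expr2 sqr_ge0.
apply/rowP => l; rewrite mxE.
by have := v0 l (mem_index_enum _); rewrite mulf_eq0 orbb => /eqP.
Qed.

(** As long as some row vanishes, the rows span a space of dimension
    less than m <= n, so there is a nonzero vector orthogonal to all of them to put
    in its place. The induction is on the number of zero rows. *)
Lemma orthogonal_rows_nonzero m n (Y : 'M[R]_(m, n)) : (m <= n)%N ->
  (forall i j, i != j -> (Y *m Y^T) i j = 0) ->
  exists Y' : 'M[R]_(m, n), [/\ forall i, row i Y' != 0,
    forall i j, i != j -> (Y' *m Y'^T) i j = 0 &
    forall i, row i Y != 0 -> row i Y' = row i Y].
Proof.
move=> le_mn; move: {2}(#|_|) (leqnn #|[set i | row i Y == 0]|) => N.
elim: N Y => [|N IH] Y.
  rewrite leqn0 cards_eq0 => /eqP no0 orthY; exists Y; split=> // i.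
  by have /finset.setP/(_ i) := no0; rewrite !inE => ->.
move=> leN orthY.
have [|[i0]] := set_0Vmem [set i | row i Y == 0].
  by move=> e; apply: IH => //; rewrite e cards0.
rewrite inE => /eqP Yi0.
have [v vY v0] : exists2 v : 'rV_n, v *m Y^T = 0 & v != 0.
  have /rowV0Pn[v /sub_kermxP vY v0] : kermx Y^T != 0.
    rewrite kermx_eq0 -row_leq_rank -ltnNge mxrank_tr.
    apply: leq_trans le_mn; rewrite ltn_neqAle rank_leq_row andbT.
    apply/negP => /row_freeP[B YB]; have := congr1 (row i0) YB.
    rewrite row_mul Yi0 mul0mx => /rowP/(_ i0); rewrite !mxE eqxx => /esym/eqP.
    by rewrite oner_eq0.
  by exists v.
pose Y1 := \matrix_(i, l) (if i == i0 then v 0 l else Y i l).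
have rowY1 i : row i Y1 = if i == i0 then v else row i Y.
  by apply/rowP => l; rewrite !mxE; case: ifP => //; rewrite mxE.
have vYi i : \sum_l v 0 l * Y i l = 0.
  have /rowP/(_ i) := vY; rewrite !mxE => vYi.
  by apply: etrans vYi; apply: eq_bigr => l _; rewrite mxE.
have [||Y' [nz orth ext]] := IH Y1.
- rewrite -ltnS; apply: leq_trans leN; apply: proper_card.
  apply/fintype.properP; split; last first.
    by exists i0; rewrite inE ?Yi0 // rowY1 eqxx.
  apply/fintype.subsetP => i; rewrite !inE rowY1; case: (i == i0) => //.
  by rewrite (negPf v0).
- move=> i j ij; rewrite mulmx_trE.
  have := orthY _ _ ij; rewrite mulmx_trE.
  case: (eqVneq i i0) ij => [->|ii0] ij; case: (eqVneq j i0) => [ji0|ji0].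
  + by rewrite ji0 eqxx in ij.
  + move=> _; apply: etrans (vYi j); apply: eq_bigr => l _.
    by rewrite !mxE eqxx (negPf ji0).
  + move=> _; apply: etrans (vYi i); apply: eq_bigr => l _.
    by rewrite !mxE ji0 eqxx (negPf ii0) mulrC.
  + move=> Yij; apply: etrans Yij; apply: eq_bigr => l _.
    by rewrite !mxE (negPf ji0) (negPf ii0).
exists Y'; split=> // i Yi.
have ii0 : (i == i0) = false by apply: contraNF Yi => /eqP->; rewrite Yi0.
by rewrite ext rowY1 ii0.
Qed.

(** Normalization of [orthogonal_rows_nonzero]. It produces both the
    orthonormal basis beginning with a given vector that the spectral theorem
    needs and the right singular vectors of a matrix, those of the singular
    value 0 included. *)
Lemma orthonormal_completion m n (Y : 'M[R]_(m, n)) : (m <= n)%N ->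
  (forall i j, i != j -> (Y *m Y^T) i j = 0) ->
  exists2 V : 'M[R]_(m, n), V *m V^T = 1%:M &
    Y = diag_mx (\row_i Num.sqrt ((Y *m Y^T) i i)) *m V.
Proof.
move=> le_mn orthY.
have [Y' [nz orth ext]] := orthogonal_rows_nonzero le_mn orthY.
pose g i := (Y' *m Y'^T) i i.
have gE i : g i = (row i Y' *m (row i Y')^T) 0 0.
  by rewrite /g !mulmx_trE; apply: eq_bigr => l _; rewrite !mxE.
have g_gt0 i : 0 < g i.
  by rewrite gE lt_neqAle mulmx_tr_ge0 eq_sym mulmx_tr_eq0 nz.
pose V := diag_mx (\row_i (Num.sqrt (g i))^-1) *m Y'.
exists V.
  apply/matrixP => i j; rewrite /V mul_diag_mx mulmx_trE.
  under eq_bigr do rewrite !mxE mulrACA.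
  rewrite -mulr_sumr -mulmx_trE [RHS]mxE; case: eqVneq => [<-|/orth->].
    by rewrite -invfM -expr2 sqr_sqrtr ?ltW // mulVf ?gt_eqF //; exact: g_gt0.
  by rewrite mulr0.
apply/row_matrixP => i; rewrite /V !row_diag_mul !mxE.
have [Yi0|Yi] := eqVneq (row i Y) 0.
  rewrite Yi0 (_ : \sum_l _ = 0) ?sqrtr0 ?scale0r //.
  apply: big1 => l _; have /rowP/(_ l) := Yi0; rewrite !mxE => ->.
  by rewrite mul0r.
have -> : \sum_j Y i j * Y^T j i = g i.
  rewrite gE ext // mulmx_trE; apply: eq_bigr => l _.
  by rewrite !mxE.
by rewrite ext // scalerA divff ?scale1r // gt_eqF ?sqrtr_gt0.
Qed.

(** Induction on the dimension: in an orthonormal basis whose first vector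
    is an eigenvector, a symmetric matrix is block diagonal. *)
Lemma sym_spectral n (A : 'M[R]_n) : A^T = A ->
  exists U : 'M[R]_n, exists2 d : 'rV[R]_n,
    U *m U^T = 1%:M & A = U^T *m diag_mx d *m U.
Proof.
elim: n A => [|n IH] A symA.
  by exists 1%:M, 0; apply/matrixP => -[].
have [a /eigenvalueP[w wA w0]] := sym_eigenvalue symA.
rewrite -[n.+1]/(1 + n)%N in A symA w wA w0 *.
have [||V VV defV] := @orthonormal_completion (1 + n) _ (col_mx w 0).
- by [].
- move=> i j; rewrite tr_col_mx trmx0 mul_col_row !mul0mx !mulmx0.
  rewrite -(splitK i) -(splitK j).
  case: (fintype.split i) => i'; case: (fintype.split j) => j' /=;
    rewrite ?block_mxEul ?block_mxEur ?block_mxEdl ?block_mxEdr ?mxE //.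
  by rewrite !ord1 eqxx.
set c := (X in diag_mx X) in defV.
have wV : w = c 0 0 *: row 0 V.
  have := congr1 (row 0) defV; rewrite row_diag_mul => <-.
  by apply/rowP => l; rewrite !mxE; case: splitP => // -[[|]] //= *; rewrite ord1.
have c0 : c 0 0 != 0 by apply: contra w0; rewrite wV => /eqP->; rewrite scale0r.
have vA : row 0 V *m A = a *: row 0 V.
  move: wA; rewrite wV -scalemxAl scalerA mulrC -scalerA.
  exact/scalerI.
have [B BV] : exists B : 'M[R]_(1 + n), B = V *m A *m V^T by eexists.
have symB : B^T = B by rewrite BV !trmx_mul trmxK symA mulmxA.
have row0B : row 0 B = a *: delta_mx 0 0.
  by rewrite BV !row_mul vA -scalemxAl -row_mul VV row1.
have B0 j : B 0 j = a *+ (j == 0).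
  by have /rowP/(_ j) := row0B; rewrite !mxE eqxx mulr_natr.
have [|U [d UU defB]] := IH (drsubmx B); first by rewrite trmx_drsub symB.
have VV' : V^T *m V = 1%:M by apply: mulmx1C.
have l0 : lshift n (0 : 'I_1) = 0 by apply/ord_inj.
have BE : B = block_mx a%:M 0 0 (drsubmx B).
  rewrite -[LHS]submxK; congr block_mx; apply/matrixP => i j.
  - by rewrite !mxE !ord1 l0 B0.
  - by rewrite !mxE ord1 l0 B0.
  - by rewrite !mxE ord1 l0 -symB mxE B0.
exists (block_mx 1%:M 0 0 U *m V), (row_mx (a%:M : 'rV_1) d).
  rewrite trmx_mul mulmxA -(mulmxA _ V) VV mulmx1 tr_block_mx mulmx_block.
  by rewrite !trmx0 trmx1 !mul1mx !mulmx0 !mul0mx !addr0 !add0r UU -scalar_mx_block.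
rewrite trmx_mul !mulmxA -[LHS]mul1mx -[LHS]mulmx1 -VV'.
rewrite -!mulmxA; congr (_ *m _); rewrite !mulmxA; congr (_ *m _).
rewrite -BV BE diag_mx_row tr_block_mx !mulmx_block !trmx0 trmx1.
rewrite !(mul1mx, mulmx0, mul0mx, addr0, add0r, mulmx1) -defB; congr block_mx.
by apply/matrixP => i j; rewrite !ord1 !mxE.
Qed.

End Spectral.

(** * Singular values and diagonalizations *)

Section SingularValues.
Variable R : rcfType.

Lemma mup_prod_XsubC (rs : seq R) x :
  mup x (\prod_(r <- rs) ('X - r%:P)) = count_mem x rs.
Proof.
elim: rs => [|r rs IH]; first by rewrite big_nil mupNroot // rootC oner_eq0.
rewrite big_cons mupM ?polyXsubC_eq0 ?monic_neq0 ?monic_prod_XsubC //= IH.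
by rewrite -(expr1 ('X - _)) mup_XsubCX eq_sym; case: (_ == _).
Qed.

Lemma count_roots_mup (p : {poly R}) x : p != 0 ->
  count_mem x (flatten [seq nseq (mup y p) y | y <- rootsR p]) = mup x p.
Proof.
move=> p0; rewrite count_flatten sumnE !big_map.
under eq_bigr do rewrite count_nseq /=.
have xP : (x \in rootsR p) = root p x by rewrite -roots_on_rootsR.
have [rx|rx] := boolP (x \in rootsR p).
  rewrite (bigD1_seq x) ?uniq_roots //= eqxx mul1n big1 ?addn0 // => y.
  by move=> /negPf->.
rewrite big_seq big1 => [|y yp]; first by rewrite mupNroot -?xP.
by case: eqVneq => // xy; rewrite -xy yp in rx.
Qed.

Lemma char_poly_diag_conj n (U : 'M[R]_n) (e : 'rV[R]_n) : U *m U^T = 1%:M ->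
  char_poly (U^T *m diag_mx e *m U) = \prod_(i < n) ('X - (e 0 i)%:P).
Proof.
move=> /mulmx1C UU; pose f := @polyC R.
have UUf : map_mx f U^T *m map_mx f U = 1%:M by rewrite -map_mxM UU map_mx1.
have -> : \prod_(i < n) ('X - (e 0 i)%:P) = char_poly (diag_mx e).
  rewrite char_poly_trig ?diag_mx_is_trig //; apply: eq_bigr => i _.
  by rewrite mxE eqxx.
rewrite /char_poly.
have -> : char_poly_mx (U^T *m diag_mx e *m U)
    = map_mx f U^T *m char_poly_mx (diag_mx e) *m map_mx f U.
  rewrite /char_poly_mx mulmxBr mulmxBl !map_mxM.
  by rewrite mul_mx_scalar -scalemxAl UUf scalemx1.
by rewrite !det_mulmx mulrAC -det_mulmx UUf det1 mul1r.
Qed.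

(** Both lists have the same multiplicities, those of the roots of the
    common characteristic polynomial. *)
Lemma eigenvalues_diag_conj n (U : 'M[R]_n) (e : 'rV[R]_n) :
  U *m U^T = 1%:M ->
  perm_eq (eigenvalues (U^T *m diag_mx e *m U)) [seq e 0 i | i : 'I_n].
Proof.
move=> UU; apply/allP => x _ /=; apply/eqP; rewrite /eigenvalues.
rewrite count_roots_mup; last by rewrite monic_neq0 // char_poly_monic.
by rewrite char_poly_diag_conj // -mup_prod_XsubC big_map big_enum.
Qed.

Lemma conj_diagE m n1 n2 (U : 'M[R]_(m, n1)) (d : 'rV[R]_m) (V : 'M[R]_(m, n2)) i j :
  (U^T *m diag_mx d *m V) i j = \sum_l U l i * d 0 l * V l j.
Proof. by rewrite mul_mx_diag mxE; apply: eq_bigr => l _; rewrite !mxE. Qed.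

Lemma gram_diag n1 n2 (U : 'M[R]_n1) (d : 'rV[R]_n1) (V : 'M[R]_(n1, n2)) :
  V *m V^T = 1%:M ->
  let X := U^T *m diag_mx d *m V in
  X *m X^T = U^T *m diag_mx (\row_i (d 0 i) ^+ 2) *m U.
Proof.
move=> VV X; rewrite /X !trmx_mul !mulmxA trmxK tr_diag_mx -(mulmxA _ V) VV.
by rewrite mulmx1 -(mulmxA _ (diag_mx d)) mulmx_diag.
Qed.

Lemma sqr_sqrt_list n (d : 'rV[R]_n) :
  [seq Num.sqrt x | x <- [seq (\row_i (d 0 i) ^+ 2) 0 i | i : 'I_n]]
    = [seq `|d 0 i| | i : 'I_n].
Proof. by rewrite -map_comp; apply: eq_map => i /=; rewrite mxE sqrtr_sqr. Qed.

(** The entries of d may have any sign and any order, so the singular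
    values are only determined as a multiset. *)
Lemma singular_values_diag n1 n2 (U : 'M[R]_n1) (d : 'rV[R]_n1)
    (V : 'M[R]_(n1, n2)) :
  U *m U^T = 1%:M -> V *m V^T = 1%:M ->
  perm_eq (singular_values (U^T *m diag_mx d *m V)) [seq `|d 0 i| | i : 'I_n1].
Proof.
move=> UU VV; rewrite /singular_values gram_diag // -sqr_sqrt_list perm_sort.
exact/perm_map/eigenvalues_diag_conj.
Qed.

Lemma gram_sym n1 n2 (X : 'M[R]_(n1, n2)) : (X *m X^T)^T = X *m X^T.
Proof. by rewrite trmx_mul trmxK. Qed.

Lemma gram_ge0 n1 n2 (X : 'M[R]_(n1, n2)) (v : 'rV_n1) :
  0 <= (v *m (X *m X^T) *m v^T) 0 0.
Proof. by rewrite mulmxA -mulmxA -trmx_mul mulmx_tr_ge0. Qed.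

Lemma size_singular_values n1 n2 (X : 'M[R]_(n1, n2)) :
  size (singular_values X) = n1.
Proof.
have [U [d UU XX]] := sym_spectral (gram_sym X).
rewrite /singular_values size_sort size_map XX.
by rewrite (perm_size (eigenvalues_diag_conj _ UU)) size_map size_enum_ord.
Qed.

Lemma sigma_ge0 n1 n2 (X : 'M[R]_(n1, n2)) i : 0 <= sigma i X.
Proof.
rewrite /sigma; have [lt_i|ge_i] := ltnP i.-1 (size (singular_values X)); last first.
  by rewrite nth_default.
by have := mem_nth 0 lt_i; rewrite mem_sort => /mapP[x _ ->]; rewrite sqrtr_ge0.
Qed.

Lemma sigma_ge n1 n2 (X : 'M[R]_(n1, n2)) i j :
  (i <= j)%N -> sigma j X <= sigma i X.
Proof.
move=> le_ij; rewrite /sigma.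
have [lt_j|ge_j] := ltnP j.-1 (size (singular_values X)); last first.
  by rewrite nth_default //; exact: sigma_ge0.
have tr : transitive (>=%R : rel R) by move=> x y z yx zy; exact: le_trans zy yx.
have rf : reflexive (>=%R : rel R) by move=> x; exact: lexx.
have so : sorted >=%R (singular_values X).
  by apply: sort_sorted => x y; exact: le_total.
apply: (sorted_leq_nth tr rf 0 so); rewrite ?inE //; last by lia.
by apply: leq_ltn_trans lt_j; lia.
Qed.

Lemma sigma_oversize n1 n2 (X : 'M[R]_(n1, n2)) i :
  (n1 < i)%N -> sigma i X = 0.
Proof.
by case: i => // i lt_i; rewrite /sigma nth_default ?size_singular_values.
Qed.

(** Symmetric functions of the singular values can be computed from any
    diagonalization. *)
Lemma big_sigma (T : Type) (idx : T) (op : Monoid.com_law idx) (f : R -> T)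
    n1 n2 (X : 'M[R]_(n1, n2)) (d : 'rV[R]_n1) :
  perm_eq (singular_values X) [seq `|d 0 i| | i : 'I_n1] ->
  \big[op/idx]_(i < n1) f (sigma i.+1 X) = \big[op/idx]_(i < n1) f `|d 0 i|.
Proof.
move=> permX; rewrite -[RHS]big_enum -(big_map (fun i => `|d 0 i|) xpredT f).
rewrite -(perm_big _ permX) (big_nth 0) size_singular_values big_mkord.
by [].
Qed.

(** The orthonormal eigenvectors are permuted so that the eigenvalues come in
    the order of the singular values. *)
Lemma gram_spectral n1 n2 (X : 'M[R]_(n1, n2)) :
  exists2 U : 'M[R]_n1, U *m U^T = 1%:M &
    X *m X^T = U^T *m diag_mx (\row_i sigma i.+1 X ^+ 2) *m U.
Proof.
have [U [d UU XX]] := sym_spectral (gram_sym X).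
have d_ge0 i : 0 <= d 0 i.
  have := gram_ge0 X (row i U).
  rewrite XX rowE trmx_mul !mulmxA -!(mulmxA _ U U^T) UU !mulmx1 -rowE.
  by rewrite row_diag_mx -scalemxAl trmx_delta mul_delta_mx !mxE !eqxx mulr1.
pose t := [tuple Num.sqrt (d 0 i) | i < n1].
have sz : size (singular_values X) == n1 by rewrite size_singular_values.
have /tuple_permP[s sE] : perm_eq (Tuple sz) t.
  rewrite /= perm_sort /= (map_comp Num.sqrt (d 0)); apply: perm_map.
  by rewrite XX; exact: eigenvalues_diag_conj.
have sigE (i : 'I_n1) : sigma i.+1 X ^+ 2 = d 0 (s i).
  have -> : sigma i.+1 X = tnth (Tuple sz) i by rewrite (tnth_nth 0).
  rewrite (tnth_nth 0) /= [singular_values X]sE -tnth_nth !tnth_mktuple.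
  by rewrite sqr_sqrtr.
exists (row_perm s U).
  apply/matrixP => i j; rewrite mulmx_trE.
  under eq_bigr do rewrite !mxE.
  by rewrite -mulmx_trE UU !mxE (inj_eq perm_inj).
rewrite XX; apply/matrixP => i j; rewrite !conj_diagE.
rewrite (reindex_inj (@perm_inj _ s)); apply: eq_bigr => l _.
by rewrite !mxE sigE.
Qed.

End SingularValues.

(** * Singular value inequalities *)

Section Inequalities.
Variable R : rcfType.

(** If U diagonalizes X X^T, the rows of U X are orthogonal and their norms are
    the singular values. Their completion to an orthonormal system needs n <= n2. *)
Lemma svd n n2 (X : 'M[R]_(n, n2)) : (n <= n2)%N ->
  exists U : 'M[R]_n, exists V : 'M[R]_(n, n2),
    [/\ U *m U^T = 1%:M, V *m V^T = 1%:M &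
        X = U^T *m diag_mx (\row_i sigma i.+1 X) *m V].
Proof.
move=> le_n; have [U UU XX] := gram_spectral X.
have YY : (U *m X) *m (U *m X)^T = diag_mx (\row_i sigma i.+1 X ^+ 2).
  rewrite trmx_mul mulmxA -(mulmxA U) XX !mulmxA UU mul1mx -mulmxA UU.
  by rewrite mulmx1.
have [|V VV defV] := @orthonormal_completion _ _ _ (U *m X) le_n.
  by move=> i j /negPf ij; rewrite YY mxE ij.
exists U, V; split=> //.
rewrite -[LHS]mul1mx -(mulmx1C UU) -!mulmxA; congr (_ *m _).
rewrite {1}defV; congr (diag_mx _ *m _); apply/rowP => i.
by rewrite YY !mxE eqxx mulr1n sqrtr_sqr ger0_norm ?sigma_ge0.
Qed.

Lemma sigma_opp n1 n2 (X : 'M[R]_(n1, n2)) i : sigma i (- X) = sigma i X.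
Proof.
by rewrite /sigma /singular_values linearN /= mulNmx mulmxN opprK.
Qed.

Lemma sigma0 n1 n2 i : sigma i (0 : 'M[R]_(n1, n2)) = 0.
Proof.
suff s0 j : sigma j.+1 (0 : 'M[R]_(n1, n2)) = 0 by case: i => [|i]; exact: s0.
have [lt_j|] := ltnP j n1; last by move=> ?; rewrite sigma_oversize.
have [U UU] := gram_spectral (0 : 'M[R]_(n1, n2)).
rewrite mul0mx => /(congr1 (fun Z => U *m Z *m U^T)).
rewrite mulmx0 mul0mx !mulmxA UU mul1mx -mulmxA UU mulmx1.
move=> /matrixP/(_ (Ordinal lt_j) (Ordinal lt_j)); rewrite !mxE eqxx mulr1n.
by move=> /esym/eqP; rewrite sqrf_eq0 => /eqP.
Qed.

Lemma pid_mx_diag n r : pid_mx r = diag_mx (\row_(l < n) (l < r)%N%:R) :> 'M[R]_n.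
Proof.
by apply/matrixP => i j; rewrite !mxE -val_eqE; case: (_ == _); case: (_ < _)%N.
Qed.

Lemma rank_row_mx m n1 n2 (A : 'M[R]_(m, n1)) (B : 'M[R]_(m, n2)) :
  (\rank (row_mx A B) <= \rank A + \rank B)%N.
Proof.
rewrite -mxrank_tr tr_row_mx -addsmxE -(mxrank_tr A) -(mxrank_tr B).
exact: mxrank_adds_leqif.
Qed.

Lemma quad_formE n (U : 'M[R]_n) (e : 'rV[R]_n) (v : 'rV[R]_n) :
  (v *m (U^T *m diag_mx e *m U) *m v^T) 0 0 =
    \sum_l e 0 l * (v *m U^T) 0 l ^+ 2.
Proof.
rewrite !mulmxA -mulmxA.
have -> : U *m v^T = (v *m U^T)^T by rewrite trmx_mul trmxK.
rewrite mul_mx_diag mxE; apply: eq_bigr => l _; rewrite !mxE.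
by rewrite mulrAC mulrC -expr2.
Qed.

Lemma norm_formE n (U : 'M[R]_n) (v : 'rV[R]_n) : U *m U^T = 1%:M ->
  (v *m v^T) 0 0 = \sum_l (v *m U^T) 0 l ^+ 2.
Proof.
move=> /mulmx1C UU; have := quad_formE U (const_mx 1) v.
rewrite diag_const_mx mulmx1 UU mulmx1 => ->.
by apply: eq_bigr => l _; rewrite mxE mul1r.
Qed.

(** Comparison on a subspace of codimension rank B shifts the index by
    rank B. A nonzero v is found in the kernel of B that is also in the span of the
    first i + rank B left singular vectors of X and orthogonal to the first i - 1
    left singular vectors of Y: the three conditions impose less than n1 linear
    equations. On such a v, |v X| is at least sigma_{i + rank B}(X) |v| and |v Y| is
    at most sigma_i(Y) |v|. *)
Lemma sigma_le_on_kernel n1 n2 n3 l (X : 'M[R]_(n1, n2)) (Y : 'M[R]_(n1, n3))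
    (B : 'M[R]_(n1, l)) i : (0 < i)%N ->
  (forall v : 'rV_n1, v *m B = 0 ->
     (v *m (X *m X^T) *m v^T) 0 0 <= (v *m (Y *m Y^T) *m v^T) 0 0) ->
  sigma (i + \rank B) X <= sigma i Y.
Proof.
case: i => // i _ leXY; set j := (i + \rank B)%N; rewrite addSn -/j.
have [lt_j|] := ltnP j n1; last first.
  by move=> ?; rewrite sigma_oversize ?sigma_ge0.
have [UX UUX XX] := gram_spectral X; have [UY UUY YY] := gram_spectral Y.
(* copid_mx j.+1 kills the coordinates up to j, pid_mx i keeps those below i,
   so v *m M = 0 states the three conditions on v at once. *)
pose M := row_mx (row_mx (UX^T *m copid_mx j.+1) (UY^T *m (pid_mx i : 'M[R]_n1))) B.
have rM : (\rank M < n1)%N.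
  apply: leq_ltn_trans (rank_row_mx _ _) _.
  have le_in : (i <= n1)%N by apply: ltnW (leq_ltn_trans (leq_addr _ _) lt_j).
  have rX := mxrankM_maxr UX^T (copid_mx j.+1).
  have rY := mxrankM_maxr UY^T (pid_mx i : 'M[R]_n1).
  rewrite rank_copid_mx // in rX; rewrite rank_pid_mx // in rY.
  have := leq_trans (rank_row_mx _ _) (leq_add rX rY).
  rewrite -(leq_add2r (\rank B)) => /leq_ltn_trans; apply.
  by rewrite -addnA -/j -{2}(subnK lt_j) ltn_add2l.
have /rowV0Pn[v /sub_kermxP] : kermx M != 0.
  by rewrite kermx_eq0 -row_leq_rank -ltnNge.
rewrite /M !mul_mx_row => /eqP; rewrite !row_mx_eq0 => /andP[/andP[vX vY] /eqP vB].
move=> v0; have vv : 0 < (v *m v^T) 0 0.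
  by rewrite lt_neqAle eq_sym mulmx_tr_eq0 v0 mulmx_tr_ge0.
have wX (l' : 'I_n1) : (j < l')%N -> (v *m UX^T) 0 l' = 0.
  move=> lt_l; move/eqP/rowP/(_ l'): vX; rewrite mulmxA /copid_mx mulmxBr mulmx1.
  by rewrite pid_mx_diag mul_mx_diag !mxE ltnS leqNgt lt_l mulr0 subr0.
have wY (l' : 'I_n1) : (l' < i)%N -> (v *m UY^T) 0 l' = 0.
  move=> lt_l; move/eqP/rowP/(_ l'): vY; rewrite mulmxA.
  by rewrite pid_mx_diag mul_mx_diag !mxE lt_l mulr1.
have := leXY v vB; rewrite XX YY !quad_formE => leXY'.
suff : sigma j.+1 X ^+ 2 * (v *m v^T) 0 0 <= sigma i.+1 Y ^+ 2 * (v *m v^T) 0 0.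
  by rewrite ler_pM2r // ler_pXn2r // nnegrE sigma_ge0.
apply: le_trans (le_trans _ leXY') _.
  rewrite (norm_formE v UUX) mulr_sumr; apply: ler_sum => l' _.
  rewrite [(\row__ _) 0 l']mxE.
  have [le_l|lt_l] := leqP l' j; last by rewrite wX // expr0n !mulr0.
  by rewrite ler_wpM2r ?sqr_ge0 // ler_pXn2r ?nnegrE ?sigma_ge0 // sigma_ge.
rewrite (norm_formE v UUY) mulr_sumr; apply: ler_sum => l' _.
rewrite [(\row__ _) 0 l']mxE.
have [le_l|lt_l] := leqP i l'; last by rewrite wY // expr0n !mulr0.
by rewrite ler_wpM2r ?sqr_ge0 // ler_pXn2r ?nnegrE ?sigma_ge0 // sigma_ge.
Qed.

(** The matrices X + Y and X agree on the kernel of Y. *)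
Lemma sigma_add_rank n1 n2 (X Y : 'M[R]_(n1, n2)) r i : (0 < i)%N ->
  (\rank Y <= r)%N -> sigma (i + r) (X + Y) <= sigma i X.
Proof.
move=> i0 rY; have le_ir : (i + \rank Y <= i + r)%N by rewrite leq_add2l.
apply: le_trans (sigma_ge _ le_ir) _.
apply: sigma_le_on_kernel => // v vY.
by rewrite !mulmxA -!(mulmxA _ _ v^T) -!trmx_mul mulmxDr vY addr0.
Qed.

Lemma sigma_rank n1 n2 (X : 'M[R]_(n1, n2)) i :
  (\rank X < i)%N -> sigma i X = 0.
Proof.
move=> lt_i; apply/eqP; rewrite eq_le sigma_ge0 andbT.
have lt0 : (0 < i - \rank X)%N by rewrite subn_gt0.
have := sigma_add_rank (0 : 'M[R]_(n1, n2)) lt0 (leqnn (\rank X)).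
by rewrite add0r sigma0 subnK // ltnW.
Qed.

(** Half of the trace duality for the nuclear norm. After cyclic permutation
    the trace is the sum of the s_i weighted by inner products of rows of two
    orthonormal systems, which are at most 1 by 2ab <= a^2 + b^2. *)
Lemma trace_le_diag n n2 (U P : 'M[R]_n) (V Q : 'M[R]_(n, n2)) (s : 'rV[R]_n) :
  U *m U^T = 1%:M -> P *m P^T = 1%:M -> V *m V^T = 1%:M -> Q *m Q^T = 1%:M ->
  (forall i, 0 <= s 0 i) ->
  \tr (P *m (U^T *m diag_mx s *m V) *m Q^T) <= \sum_i s 0 i.
Proof.
move=> UU PP VV QQ s0; pose Z := U *m P^T *m Q.
have ZZ : Z *m Z^T = 1%:M.
  rewrite /Z !trmx_mul trmxK !mulmxA -(mulmxA _ Q) QQ mulmx1.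
  by rewrite -(mulmxA _ _ P) (mulmx1C PP) mulmx1 UU.
have -> : \tr (P *m (U^T *m diag_mx s *m V) *m Q^T) = \tr (diag_mx s *m (V *m Z^T)).
  rewrite /Z !trmx_mul trmxK -!mulmxA mxtrace_mulC !mulmxA.
  by rewrite -!mulmxA mxtrace_mulC !mulmxA.
rewrite /mxtrace; apply: ler_sum => i _; rewrite mul_diag_mx mxE.
rewrite -[leRHS]mulr1 ler_wpM2l // mxE.
have /matrixP/(_ i i) := VV; have /matrixP/(_ i i) := ZZ.
rewrite !mulmx_trE !mxE eqxx => ZE VE.
have : 0 <= \sum_l (V i l - Z i l) ^+ 2.
  by apply: sumr_ge0 => l _; exact: sqr_ge0.
have -> : \sum_l (V i l - Z i l) ^+ 2 = \sum_l V i l * V i l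
    - 2 * (\sum_l V i l * Z^T l i) + \sum_l Z i l * Z i l.
  rewrite mulr_sumr -sumrB -big_split; apply: eq_bigr => l _ /=.
  by rewrite [Z^T l i]mxE; ring.
by rewrite ZE VE /=; lra.
Qed.

Definition nuclear n n2 (X : 'M[R]_(n, n2)) : R := \sum_(i < n) sigma i.+1 X.

Lemma nuclear_ge0 n n2 (X : 'M[R]_(n, n2)) : 0 <= nuclear X.
Proof. by apply: sumr_ge0 => i _; exact: sigma_ge0. Qed.

(** The nuclear norm of A + B is attained as the trace of P (A + B) Q^T for the
    singular vectors of A + B, and this trace is linear in A and B. *)
Lemma nuclearD n n2 (A B : 'M[R]_(n, n2)) : (n <= n2)%N ->
  nuclear (A + B) <= nuclear A + nuclear B.
Proof.
move=> le_n; have [P [Q [PP QQ AB]]] := svd (A + B) le_n.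
have bound X : \tr (P *m X *m Q^T) <= nuclear X.
  have -> : nuclear X = \sum_i (\row_(i < n) sigma i.+1 X) 0 i.
    by apply: eq_bigr => i _; rewrite mxE.
  have [U [V [UU VV {1}->]]] := svd X le_n.
  apply: trace_le_diag => // i; rewrite mxE; exact: sigma_ge0.
have -> : nuclear (A + B) = \tr (P *m (A + B) *m Q^T).
  rewrite {2}AB !mulmxA PP mul1mx -mulmxA QQ mulmx1 mxtrace_diag.
  by apply: eq_bigr => i _; rewrite mxE.
by rewrite mulmxDr mulmxDl linearD /= lerD.
Qed.

Lemma rank_diag_le n (d : 'rV[R]_n) :
  (\rank (diag_mx d) <= \sum_(i < n) (d 0%R i != 0%R))%N.
Proof.
rewrite diag_mx_sum_delta.
elim/big_rec2: _ => [|i m A _ le_A]; first by rewrite mxrank0.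
apply: leq_trans (mxrank_add _ _) (leq_add _ le_A).
have [->|d0] := eqVneq (d 0 i) 0; first by rewrite scale0r mxrank0.
by apply: leq_trans (mxrank_scale _ _) _; rewrite mxrank_delta.
Qed.

(** X2 keeps the singular values above the threshold t and X1 the others. *)
Lemma truncate_svd n n2 (X : 'M[R]_(n, n2)) t : (n <= n2)%N -> 0 <= t ->
  exists X1 X2 : 'M[R]_(n, n2), X = X1 + X2 /\
    nuclear X1 + t * (\rank X2)%:R <= \sum_(i < n) Num.min (sigma i.+1 X) t.
Proof.
move=> le_n t0; have [U [V [UU VV defX]]] := svd X le_n.
pose big (i : 'I_n) := t < sigma i.+1 X.
pose d1 := \row_i (if big i then 0 else sigma i.+1 X).
pose d2 := \row_i (if big i then sigma i.+1 X else 0).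
exists (U^T *m diag_mx d1 *m V), (U^T *m diag_mx d2 *m V); split.
  rewrite -mulmxDl -mulmxDr -linearD {1}defX; congr (_ *m diag_mx _ *m _).
  by apply/rowP => i; rewrite !mxE; case: ifP; rewrite ?addr0 ?add0r.
rewrite /nuclear (big_sigma _ id (singular_values_diag d1 UU VV)) /=.
have rk : (\rank (U^T *m diag_mx d2 *m V) <= \sum_(i < n) big i)%N.
  apply: leq_trans (mxrankM_maxl _ _) (leq_trans (mxrankM_maxr _ _) _).
  apply: leq_trans (rank_diag_le _) _; apply: leq_sum => i _.
  by rewrite mxE; case: ifP; rewrite ?eqxx //; case: (_ != _).
rewrite -(ler_nat R) in rk.
apply: le_trans (lerD (lexx _) (ler_wpM2l t0 rk)) _.
rewrite natr_sum mulr_sumr -big_split; apply: ler_sum => i _ /=.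
rewrite mxE /big; case: ltP => le_t.
  by rewrite normr0 add0r mulr1.
by rewrite mulr0 addr0 ger0_norm ?sigma_ge0.
Qed.

(** The first rank X2 terms are at most t, and the remaining ones are bounded
    by the singular values of X1 through a shift of the index by rank X2. *)
Lemma min_sigma_le n n2 (X1 X2 : 'M[R]_(n, n2)) t : 0 <= t ->
  \sum_(i < n) Num.min (sigma i.+1 (X1 + X2)) t
    <= nuclear X1 + t * (\rank X2)%:R.
Proof.
move=> t0; set r := \rank X2.
have [le_r|/ltnW le_r] := leqP n r.
  rewrite -[leLHS]add0r; apply: lerD (nuclear_ge0 _) _.
  apply: le_trans (_ : \sum_(i < n) t <= _).
    by apply: ler_sum => i _; rewrite ge_min lexx orbT.
  by rewrite sumr_const card_ord -(mulr_natr t n) ler_wpM2l // ler_nat.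
rewrite -(big_mkord xpredT (fun i => Num.min (sigma i.+1 (X1 + X2)) t)).
rewrite (big_cat_nat (leq0n r) le_r) /= addrC; apply: lerD.
  rewrite -{1}[r]add0n big_addn /nuclear -(big_mkord xpredT (fun i => sigma i.+1 X1)).
  rewrite [leRHS](big_cat_nat (leq0n (n - r)) (leq_subr _ _)) /=.
  apply: ler_wpDr; first by apply: sumr_ge0 => i _; exact: sigma_ge0.
  apply: ler_sum => i _; apply: le_trans (_ : sigma (i.+1 + r) (X1 + X2) <= _).
    by rewrite ge_min lexx.
  exact: sigma_add_rank.
apply: le_trans (_ : \sum_(0 <= i < r) t <= _).
  by apply: ler_sum => i _; rewrite ge_min lexx orbT.
by rewrite sumr_const_nat subn0 -(mulr_natr t r).
Qed.

Lemma min_sigmaD n n2 (A B : 'M[R]_(n, n2)) t : (n <= n2)%N -> 0 <= t ->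
  \sum_(i < n) Num.min (sigma i.+1 (A + B)) t <=
  \sum_(i < n) Num.min (sigma i.+1 A) t + \sum_(i < n) Num.min (sigma i.+1 B) t.
Proof.
move=> le_n t0.
have [A1 [A2 [-> leA]]] := truncate_svd A le_n t0.
have [B1 [B2 [-> leB]]] := truncate_svd B le_n t0.
rewrite addrACA; apply: le_trans (min_sigma_le _ _ t0) (le_trans _ (lerD leA leB)).
rewrite addrACA -mulrDr lerD ?nuclearD // ler_wpM2l //.
by rewrite -natrD ler_nat mxrank_add.
Qed.

End Inequalities.

(** * Sums of concave functions *)

Section Concave.
Variable R : realFieldType.

(** Abel summation. The induction bounds the sum of the first M terms below by
    c * G M for every lower bound c of the first M slopes: c = s M absorbs the
    negative part of the next term, and c = 0 gives the claim. *)
Lemma abel_nonneg (s G : nat -> R) N :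
  (forall j, 0 <= G j) -> G 0%N = 0 ->
  (forall j, (j < N)%N -> 0 <= s j) ->
  (forall i j, (i <= j < N)%N -> s j <= s i) ->
  0 <= \sum_(j < N) s j * (G j.+1 - G j).
Proof.
move=> G0 G00 s0 s_decr.
suff H M c : (M <= N)%N -> (forall j, (j < M)%N -> c <= s j) ->
    c * G M <= \sum_(j < M) s j * (G j.+1 - G j).
  by have := H N 0 (leqnn N) s0; rewrite mul0r.
elim: M c => [|M IH] c le_M c_le; first by rewrite G00 mulr0 big_ord0.
rewrite big_ord_recr /=.
have H : s M * G M <= \sum_(j < M) s j * (G j.+1 - G j).
  apply: IH => [|j lt_j]; first exact: ltnW.
  by apply: s_decr; rewrite (ltnW lt_j).
apply: le_trans (lerD H (lexx _)).
by rewrite mulrBr addrC subrK ler_wpM2r // c_le.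
Qed.

(** Here g y is the slope of a line supporting f from above at y, which encodes
    concavity, and g >= 0 makes f nondecreasing. On the increasing list ts of the
    points x i and 0, f agrees with its piecewise linear interpolation, whose
    slopes s_j are nonnegative and decrease. So f (x i) is the sum over j of s_j
    times the increment of min(x i, t) from t = tt j to tt j.+1, and Abel summation
    reduces the claim to the hypothesis at the points tt j. The weights may have
    both signs, which is how an inequality between sums is expressed. *)
Lemma concave_sum_ge0 (f g : R -> R) (I : finType) (w x : I -> R) :
  f 0 = 0 -> (forall y, 0 < y -> 0 <= g y) ->
  (forall z y, 0 <= z -> 0 < y -> f z <= f y + g y * (z - y)) ->
  (forall i, 0 <= x i) ->
  (forall t, 0 <= t -> 0 <= \sum_i w i * Num.min (x i) t) ->
  0 <= \sum_i w i * f (x i).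
Proof.
move=> f0 g0 fg x0 minw.
pose ts := sort <=%R (undup (0 :: [seq x i | i : I])).
pose tt := nth 0 ts.
have mem_ts y : (y \in ts) = (y == 0) || (y \in [seq x i | i : I]).
  by rewrite mem_sort mem_undup inE.
have ts_sorted : sorted <%R ts by rewrite sort_lt_sorted undup_uniq.
have ts_ge0 y : y \in ts -> 0 <= y.
  by rewrite mem_ts => /orP[/eqP->//|/mapP[i _ ->]].
have ts_gt0 : (0 < size ts)%N.
  by rewrite lt0n size_eq0; apply/eqP => ts0; have := mem_ts 0; rewrite ts0 eqxx.
have tt_lt i j : (i < j < size ts)%N -> tt i < tt j.
  move=> /andP[lt_ij lt_j].
  by apply: (sorted_ltn_nth lt_trans) => //; rewrite inE // (ltn_trans lt_ij).
have tt_le i j : (i <= j < size ts)%N -> tt i <= tt j.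
  move=> /andP[]; rewrite leq_eqVlt => /predU1P[->//|lt_ij] lt_j.
  by rewrite ltW // tt_lt // lt_ij.
have tt_ge0 j : 0 <= tt j.
  have [lt_j|ge_j] := ltnP j (size ts); first by rewrite ts_ge0 // mem_nth.
  by rewrite /tt nth_default.
have tt0 : tt 0%N = 0.
  have t0 : 0 \in ts by rewrite mem_ts eqxx.
  apply/eqP; rewrite eq_le tt_ge0 andbT -[leRHS](nth_index 0 t0).
  by apply: tt_le; rewrite leq0n index_mem.
pose N := (size ts).-1.
have szN : size ts = N.+1 by rewrite prednK.
have tt_gt0 j : (0 < j <= N)%N -> 0 < tt j.
  by move=> lt_j; rewrite -tt0 tt_lt // szN ltnS.
pose s j := (f (tt j.+1) - f (tt j)) / (tt j.+1 - tt j).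
have step_gt0 j : (j < N)%N -> 0 < tt j.+1 - tt j.
  by move=> lt_j; rewrite subr_gt0 tt_lt // szN !ltnS leqnn.
(* Chord slopes are compared through the supporting slopes g, which decrease:
   g (tt j.+1) <= s j <= g (tt j). *)
have g_le y z : 0 < y -> y <= z -> g z <= g y.
  move=> y0; rewrite le_eqVlt => /predU1P[->//|lt_yz].
  have z0 := lt_trans y0 lt_yz.
  have h1 := fg _ _ (ltW z0) y0; have h2 := fg _ _ (ltW y0) z0.
  by rewrite -(ler_pM2r (_ : 0 < z - y)) ?subr_gt0 //; lra.
have s_ge j : (j < N)%N -> g (tt j.+1) <= s j.
  move=> lt_j; rewrite ler_pdivlMr ?step_gt0 //.
  by have := fg _ _ (tt_ge0 j) (tt_gt0 j.+1 lt_j); lra.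
have s_le j : (0 < j < N)%N -> s j <= g (tt j).
  move=> /andP[j0 lt_j]; rewrite ler_pdivrMr ?step_gt0 //.
  have := fg _ _ (tt_ge0 j.+1) (tt_gt0 j _); rewrite j0 (ltnW lt_j) => /(_ isT).
  by lra.
pose incr y j := Num.min y (tt j.+1) - Num.min y (tt j).
(* The summand at j is f (tt j.+1) - f (tt j) below the index of x i and 0 from
   there on, so the sum telescopes. *)
have fE i : f (x i) = \sum_(j < N) s j * incr (x i) j.
  have xi : x i \in ts by rewrite mem_ts map_f ?orbT // mem_enum.
  have lt_k : (index (x i) ts < size ts)%N by rewrite index_mem.
  rewrite -(nth_index 0 xi) -/tt; move: (index _ _) lt_k => k.
  rewrite szN ltnS => le_k.
  rewrite -(big_mkord xpredT (fun j => s j * incr (tt k) j)) /incr.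
  rewrite (big_cat_nat (leq0n k) le_k) /=.
  rewrite [X in _ + X]big_nat_cond [X in _ + X]big1 ?addr0.
    rewrite big_nat_cond (eq_bigr (fun j => f (tt j.+1) - f (tt j))).
      by rewrite -big_nat_cond telescope_sumr // tt0 f0 subr0.
    move=> j; rewrite andbT => /= lt_j.
    rewrite !min_r ?tt_le ?szN ?ltnS ?lt_j ?(ltnW lt_j) ?le_k //.
    by rewrite /s divfK // gt_eqF // step_gt0 // (leq_trans lt_j).
  move=> j; rewrite andbT => /andP[le_kj lt_j].
  rewrite !min_l ?subrr ?mulr0 // tt_le // szN ltnS.
    by rewrite le_kj (ltnW lt_j).
  by rewrite (leqW le_kj) lt_j.
under eq_bigr do rewrite fE mulr_sumr.
rewrite exchange_big /=.
pose G j := \sum_i w i * Num.min (x i) (tt j).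
rewrite (eq_bigr (fun j : 'I_N => s j * (G j.+1 - G j))); last first.
  move=> j _; rewrite /G /incr -sumrB mulr_sumr; apply: eq_bigr => i _; ring.
apply: abel_nonneg.
- by move=> j; exact: minw.
- by rewrite /G big1 // => i _; rewrite tt0 min_r // mulr0.
- by move=> j lt_j; apply: le_trans (s_ge _ lt_j); apply/g0/tt_gt0.
- move=> i j; rewrite leq_eqVlt => /andP[/predU1P[->//|lt_ij] lt_j].
  have lt_i := ltn_trans lt_ij lt_j.
  apply: le_trans (s_le j _) (le_trans _ (s_ge i lt_i)).
    by rewrite lt_j (leq_ltn_trans _ lt_ij).
  by apply: g_le; [exact: tt_gt0 | rewrite tt_le // lt_ij szN ltnS ltnW].
Qed.

End Concave.

Section Power.
Variables (R : realType) (p : R).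
Hypotheses (p_gt0 : 0 < p) (p_lt1 : p < 1).

(** This is the weighted arithmetic-geometric inequality
    z^p y^(1-p) <= p z + (1-p) y, divided by y^(1-p). *)
Lemma powR_tangent z y : 0 <= z -> 0 < y ->
  z `^ p <= y `^ p + p * y `^ (p - 1) * (z - y).
Proof.
move=> z0 y0; have q0 : 0 < 1 - p by rewrite subr_gt0.
have H : z `^ p * y `^ (1 - p) <= z * p + y * (1 - p).
  have := @conjugate_powR R (z `^ p) (y `^ (1 - p)) p^-1 (1 - p)^-1
    (powR_ge0 _ _) (powR_ge0 _ _).
  rewrite !invr_gt0 !invrK (addrC p) subrK => /(_ p_gt0 q0 erefl).
  rewrite -!powRrM mulfV ?gt_eqF // mulfV ?gt_eqF //.
  by rewrite !powRr1 // ltW.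
have y1 : y `^ (p - 1) * y = y `^ p.
  rewrite -{2}(powRr1 (ltW y0)) -powRD ?subrK //.
  by rewrite (gt_eqF y0) implybT.
have yy : y `^ (1 - p) * y `^ (p - 1) = 1.
  rewrite -powRD; last by rewrite (gt_eqF y0) implybT.
  by rewrite (_ : 1 - p + (p - 1) = 0) ?powRr0 //; ring.
have := ler_wpM2r (powR_ge0 y (p - 1)) H.
rewrite -(mulrA (z `^ p)) yy mulr1 => /le_trans; apply.
rewrite -y1 le_eqVlt; apply/orP; left; apply/eqP; ring.
Qed.

Lemma sum_powR_le (I : finType) (a b c : I -> R) :
  (forall i, 0 <= a i) -> (forall i, 0 <= b i) -> (forall i, 0 <= c i) ->
  (forall t, 0 <= t -> \sum_i Num.min (c i) t
     <= \sum_i Num.min (a i) t + \sum_i Num.min (b i) t) ->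
  \sum_i c i `^ p <= \sum_i a i `^ p + \sum_i b i `^ p.
Proof.
move=> a0 b0 c0 H.
pose x (u : I + I + I) := match u with
  | inl (inl i) => a i | inl (inr i) => b i | inr i => c i end.
pose w (u : I + I + I) : R := if u is inl _ then 1 else -1.
have E (h : R -> R) :
    \sum_u w u * h (x u) = \sum_i h (a i) + \sum_i h (b i) - \sum_i h (c i).
  rewrite big_sumType big_sumType /= -sumrN.
  by congr (_ + _ + _); apply: eq_bigr => i _; rewrite ?mul1r ?mulN1r.
rewrite -subr_ge0 -(E (fun y => y `^ p)).
apply: (@concave_sum_ge0 R (fun y => y `^ p) (fun y => p * y `^ (p - 1))).
- by rewrite powR0 // gt_eqF.
- by move=> y _; rewrite mulr_ge0 ?powR_ge0 ?ltW.
- exact: powR_tangent.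
- by case=> [[]|].
- by move=> t t0; rewrite (E (fun y => Num.min y t)) subr_ge0 H.
Qed.

End Power.

(** * The Schatten functional *)

(** The numerical part of sufficiency: x and w are the sequences of p-th powers
    of the singular values of X0 + W and W. *)
Lemma head_tail_lt (R : realDomainType) (x w : nat -> R) (S0 : R) k n :
  (0 < k <= n)%N -> (forall i, 0 <= x i) -> (forall i, 0 <= w i) ->
  (forall i j, (i <= j)%N -> w j <= w i) -> 0 < w 0%N ->
  S0 <= \sum_(0 <= i < k) x i + \sum_(0 <= i < k) w i ->
  (forall i, w (i + k)%N <= x i) ->
  \sum_(0 <= i < 2 * k) w i <= \sum_(2 * k <= i < n) w i ->
  S0 < \sum_(0 <= i < n) x i.
Proof.
move=> /andP[k_gt0 le_k] x_ge0 w_ge0 w_decr w0 head wx nsp.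
have tail : \sum_(2 * k <= i < n) w i <= \sum_(k <= i < n) x i.
  rewrite mul2n -addnn big_addn.
  (* When n < 2k the tail of w is empty. *)
  have [le_kn|lt_nk] := leqP k (n - k); last first.
    by rewrite big_geq ?(ltnW lt_nk) // sumr_ge0.
  rewrite [leRHS](big_cat_nat le_kn (leq_subr _ _)) /=.
  by rewrite ler_wpDr ?sumr_ge0 // ler_sum.
have lt_k2k : (k < 2 * k)%N by rewrite mul2n -addnn -{1}[k]addn0 ltn_add2l.
have gap : 0 < \sum_(k <= i < 2 * k) w i.
  rewrite lt_neqAle sumr_ge0 ?andbT //; apply/negP => /eqP gap0.
  have wk : w k = 0.
    apply/eqP; rewrite eq_le w_ge0 andbT gap0 big_ltn //.
    by rewrite ler_wpDr // sumr_ge0.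
  have tail0 : \sum_(2 * k <= i < n) w i = 0.
    rewrite big_nat_cond big1 // => i; rewrite andbT => /andP[le_i _].
    apply/eqP; rewrite eq_le w_ge0 andbT -wk w_decr //.
    exact: leq_trans (ltnW lt_k2k) le_i.
  move: nsp; rewrite tail0 leNgt => /negP; apply.
  by rewrite big_ltn ?muln_gt0 // ltr_wpDr ?sumr_ge0.
rewrite (big_cat_nat (leq0n k) le_k) /=.
move: nsp; rewrite (big_cat_nat (leq0n k) (ltnW lt_k2k)) /=.
lra.
Qed.

Section Recovery.
Variables (R : realType) (p : R).
Hypotheses (p_gt0 : 0 < p) (p_lt1 : p < 1).

Lemma schattenE n n2 (X : 'M[R]_(n, n2)) :
  schatten p X = \sum_(0 <= i < n) sigma i.+1 X `^ p.
Proof. by rewrite /schatten big_add1. Qed.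

Lemma schatten_ord n n2 (X : 'M[R]_(n, n2)) :
  schatten p X = \sum_(i < n) sigma i.+1 X `^ p.
Proof. by rewrite schattenE big_mkord. Qed.

Lemma schatten_diag n n2 (U : 'M[R]_n) (d : 'rV[R]_n) (V : 'M[R]_(n, n2)) :
  U *m U^T = 1%:M -> V *m V^T = 1%:M ->
  schatten p (U^T *m diag_mx d *m V) = \sum_(i < n) `|d 0 i| `^ p.
Proof.
move=> UU VV; rewrite schatten_ord.
exact: (big_sigma _ (fun y => y `^ p) (singular_values_diag d UU VV)).
Qed.

(** The triangle inequality of Rotfel'd and McCarthy for p < 1. *)
Lemma schattenD n n2 (A B : 'M[R]_(n, n2)) : (n <= n2)%N ->
  schatten p (A + B) <= schatten p A + schatten p B.
Proof.
move=> le_n; rewrite !schatten_ord; apply: sum_powR_le => //.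
- by move=> i; exact: sigma_ge0.
- by move=> i; exact: sigma_ge0.
- by move=> i; exact: sigma_ge0.
- by move=> t t0; exact: min_sigmaD.
Qed.

(** An orthogonal projection does not increase the norm of any row vector v Y. *)
Lemma sigma_mulmx_proj n n2 (Y : 'M[R]_(n, n2)) (Q : 'M[R]_n2) i : (0 < i)%N ->
  Q^T = Q -> Q *m Q = Q -> sigma i (Y *m Q) <= sigma i Y.
Proof.
move=> i0 symQ QQ; rewrite -[i in leLHS]addn0 -(mxrank0 R n 1).
apply: sigma_le_on_kernel => // v _; set w := v *m Y.
have -> : v *m (Y *m Q *m (Y *m Q)^T) *m v^T = w *m Q *m w^T.
  by rewrite /w !trmx_mul symQ !mulmxA -(mulmxA _ Q Q) QQ.
have -> : v *m (Y *m Y^T) *m v^T = w *m w^T by rewrite /w trmx_mul !mulmxA.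
have := mulmx_tr_ge0 (w - w *m Q).
have -> : (w - w *m Q) *m (w - w *m Q)^T = w *m w^T - w *m Q *m w^T.
  rewrite [(w - _)^T]linearB /= (trmx_mul w Q) symQ mulmxBr !mulmxBl !mulmxA.
  by rewrite -(mulmxA _ Q Q) QQ subrr subr0.
by rewrite mxE [X in _ + X]mxE subr_ge0.
Qed.

(** Q is the orthogonal projection onto the span of the first k right singular
    vectors of C, so C Q = C while A Q and B Q have rank at most k. *)
Lemma schatten_rankD n n2 (C A B : 'M[R]_(n, n2)) k : (n <= n2)%N -> (k <= n)%N ->
  (\rank C <= k)%N -> C = A + B ->
  schatten p C <= \sum_(0 <= i < k) sigma i.+1 A `^ p
                      + \sum_(0 <= i < k) sigma i.+1 B `^ p.
Proof.
move=> le_n le_k rk CAB; have [U [V [UU VV defC]]] := svd C le_n.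
pose Q : 'M[R]_n2 := V^T *m pid_mx k *m V.
have symQ : Q^T = Q by rewrite /Q !trmx_mul trmxK tr_pid_mx mulmxA.
have QQ : Q *m Q = Q.
  have -> : Q *m Q = V^T *m (pid_mx k *m (V *m V^T) *m pid_mx k) *m V.
    by rewrite /Q !mulmxA.
  by rewrite VV mulmx1 pid_mx_id.
have rkQ : (\rank Q <= k)%N.
  apply: leq_trans (mxrankM_maxl _ _) (leq_trans (mxrankM_maxr _ _) _).
  by rewrite rank_pid_mx.
have CQ : C *m Q = C.
  rewrite defC /Q !mulmxA -(mulmxA _ V) VV mulmx1; congr (_ *m _).
  rewrite -mulmxA pid_mx_diag mulmx_diag; congr (_ *m diag_mx _).
  apply/rowP => i; rewrite !mxE.
  have [lt_i|le_i] := ltnP i k; first by rewrite mulr1.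
  have -> : sigma i.+1 C = 0.
    by apply: sigma_rank; rewrite ltnS (leq_trans rk).
  by rewrite mul0r.
have head (Y : 'M[R]_(n, n2)) :
    schatten p (Y *m Q) <= \sum_(0 <= i < k) sigma i.+1 Y `^ p.
  rewrite schattenE (big_cat_nat (leq0n k) le_k) /=.
  rewrite [X in _ + X]big_nat_cond [X in _ + X]big1 ?addr0.
    apply: ler_sum => i _; rewrite ge0_ler_powR ?nnegrE ?sigma_ge0 ?(ltW p_gt0) //.
    exact: sigma_mulmx_proj.
  move=> i; rewrite andbT => /andP[le_i _].
  rewrite sigma_rank ?powR0 ?gt_eqF //.
  exact: leq_ltn_trans (mxrankM_maxr _ _) (leq_ltn_trans rkQ _).
rewrite -CQ CAB mulmxDl; apply: le_trans (schattenD _ _ le_n) _.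
by rewrite lerD.
Qed.

Lemma sigma_eq0 n n2 (X : 'M[R]_(n, n2)) : (n <= n2)%N -> sigma 1 X = 0 -> X = 0.
Proof.
move=> le_n s1; have [U [V [_ _ ->]]] := svd X le_n.
rewrite (_ : \row_i _ = 0) ?linear0 ?mulmx0 ?mul0mx //.
apply/rowP => i; rewrite !mxE; apply/eqP; rewrite eq_le sigma_ge0 andbT -s1.
exact: sigma_ge.
Qed.

Lemma schatten_lt n n2 (X0 W : 'M[R]_(n, n2)) k : (n <= n2)%N -> (k <= n)%N ->
  (0 < k)%N -> (\rank X0 <= k)%N -> W != 0 ->
  \sum_(0 <= i < 2 * k) sigma i.+1 W `^ p
     <= \sum_(2 * k <= i < n) sigma i.+1 W `^ p ->
  schatten p X0 < schatten p (X0 + W).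
Proof.
move=> le_n le_k k_gt0 rk W0 nsp; rewrite (schattenE (X0 + W)).
apply: (@head_tail_lt R (fun i => sigma i.+1 (X0 + W) `^ p)
  (fun i => sigma i.+1 W `^ p) _ k n) => //.
- by rewrite k_gt0.
- by move=> i; exact: powR_ge0.
- by move=> i; exact: powR_ge0.
- move=> i j le_ij; rewrite ge0_ler_powR ?nnegrE ?sigma_ge0 ?(ltW p_gt0) //.
  exact: sigma_ge.
- rewrite powR_gt0 // lt_neqAle sigma_ge0 andbT eq_sym.
  by apply: contra W0 => /eqP s1; apply/eqP/sigma_eq0.
- have X0E : X0 = X0 + W + - W by rewrite addrK.
  apply: le_trans (schatten_rankD le_n le_k rk X0E) _.
  apply: lerD; first exact: lexx.
  by apply: ler_sum => i _; rewrite sigma_opp lexx.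
- move=> i; rewrite ge0_ler_powR ?nnegrE ?sigma_ge0 ?(ltW p_gt0) //.
  have WE : W = X0 + W - X0 by rewrite addrAC subrr add0r.
  rewrite -addSn [X in sigma _ X <= _]WE.
  by apply: sigma_add_rank; rewrite ?mxrank_opp.
Qed.

(** X0 is minus the head of the singular value decomposition of W. Its
    diagonal must have exactly k nonzero entries, so -1 stands in for a vanishing
    singular value of index at most k; such an entry contributes 1 to both X0 and
    X0 + W and cancels in the difference. *)
Lemma exists_rank_schattenB n n2 (W : 'M[R]_(n, n2)) k :
  (n <= n2)%N -> (k <= n)%N ->
  exists2 X0 : 'M[R]_(n, n2), \rank X0 = k &
    schatten p X0 - schatten p (X0 + W) =
    \sum_(0 <= i < k) sigma i.+1 W `^ p - \sum_(k <= i < n) sigma i.+1 W `^ p.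
Proof.
move=> le_n le_k; have [U [V [UU VV defW]]] := svd W le_n.
pose s := \row_(i < n) sigma i.+1 W.
pose e := \row_(i < n) (if s 0 i == 0 then -1 else - s 0 i).
pose c := \row_(i < n) (e 0 i * (i < k)%:R).
have diag_c : diag_mx c = diag_mx e *m pid_mx k.
  rewrite pid_mx_diag mulmx_diag; congr diag_mx.
  by apply/rowP => i; rewrite !mxE.
exists (U^T *m diag_mx c *m V).
  rewrite mxrankMfree; last by apply/row_freeP; exists V^T.
  rewrite diag_c mulmxA eqmxMfull ?rank_pid_mx //.
  rewrite row_full_unit unitmx_mul unitmx_tr.
  have -> /= : U \in unitmx by case: (mulmx1_unit UU).
  rewrite unitmxE det_diag unitfE; apply/prodf_neq0 => i _.
  rewrite [e 0 i]mxE; case: (eqVneq (s 0 i) 0) => [_|s0].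
    by rewrite oppr_eq0 oner_eq0.
  by rewrite oppr_eq0.
have -> : U^T *m diag_mx c *m V + W = U^T *m diag_mx (c + s) *m V.
  by rewrite {1}defW -mulmxDl -mulmxDr -linearD.
rewrite !schatten_diag // -sumrB.
pose F i := sigma i.+1 W `^ p * (if (i < k)%N then 1 else -1).
transitivity (\sum_(0 <= i < n) F i); last first.
  rewrite (big_cat_nat (leq0n k) le_k) /= -sumrN; congr (_ + _).
    by apply: eq_big_nat => i /andP[_ lt_i]; rewrite /F lt_i mulr1.
  by apply: eq_big_nat => i /andP[le_i _]; rewrite /F ltnNge le_i mulrN1.
rewrite big_mkord; apply: eq_bigr => i _; rewrite /F /c /e !mxE.
have s0 := sigma_ge0 W i.+1.
case: ltnP => [lt_i|le_i]; rewrite ?mulr1 ?mulr0.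
  case: eqVneq => [->|nz]; first by rewrite addr0 subrr powR0 ?gt_eqF.
  by rewrite addNr normrN normr0 powR0 ?gt_eqF // subr0 ger0_norm.
by rewrite normr0 powR0 ?gt_eqF // add0r add0r ger0_norm // mulrN1.
Qed.

End Recovery.

(** * The theorem *)

Local Open Scope classical_set_scope.
Local Open Scope ring_scope.

Theorem theorem3 (R : realType) (p : R) (n n2 m k : nat)
    (A : {linear 'M[R]_(n, n2) -> 'cV[R]_m})
    (p_gt0 : 0 < p) (p_lt1 : p < 1)
    (n_gt0 : (0 < n)%N) (le_n_n2 : (n <= n2)%N) (m_gt0 : (0 < m)%N)
    (k_gt0 : (0 < k)%N) (le_k_n : (k <= n)%N) :
  ((forall W : 'M[R]_(n, n2), A W = 0 ->
      \sum_(1 <= i < (2 * k).+1) sigma i W `^ p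
        <= \sum_((2 * k).+1 <= i < n.+1) sigma i W `^ p) ->
   forall X0 : 'M[R]_(n, n2), \rank X0 = k ->
     global_minimizers (schatten p) [set X | A X = A X0] = [set X0])
  /\
  ((forall X0 : 'M[R]_(n, n2), \rank X0 = k ->
     global_minimizers (schatten p) [set X | A X = A X0] = [set X0]) ->
   forall W : 'M[R]_(n, n2), A W = 0 ->
      \sum_(1 <= i < k.+1) sigma i W `^ p
        <= \sum_(k.+1 <= i < n.+1) sigma i W `^ p).
Proof.
split=> [nsp X0 rk|uniq_min W AW0].
  have lt_feasible Y : A Y = A X0 -> Y != X0 -> schatten p X0 < schatten p Y.
    move=> AY YX0; have -> : Y = X0 + (Y - X0) by rewrite addrC subrK.
    apply: (@schatten_lt R p p_gt0 p_lt1 n n2 X0 (Y - X0) k) => //;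
      rewrite ?rk ?subr_eq0 //.
    have := nsp (Y - X0); rewrite linearB /= AY subrr !big_add1 /= => /(_ erefl).
    exact.
  apply/seteqP; split=> [Y [AY minY]|_ ->].
    apply/eqP; apply: contraT => YX0; have := minY X0 erefl.
    by rewrite leNgt lt_feasible.
  split=> [|Y AY]; first by [].
  have [->|YX0] := eqVneq Y X0; first exact: lexx.
  exact/ltW/lt_feasible.
have [X0 rk eqX0] := exists_rank_schattenB p_gt0 W le_n_n2 le_k_n.
have [_ minX0] : global_minimizers (schatten p) [set X | A X = A X0] X0.
  by rewrite (uniq_min X0 rk).
have AX : A (X0 + W) = A X0.
  by rewrite linearD AW0 addr0.
have leX0 := minX0 _ AX; rewrite -subr_le0 eqX0 subr_le0 in leX0.
by rewrite 2!big_add1; exact: leX0.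
Qed.
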